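(* Let an instance of the transportation problem with market choice (TPMC) be given, with finite bipartite graph $G(V_1\cup V_2,E)$, supply capacities $s_i\in\mathbb{N}$ ($i\in V_1$) and demands $d_j\in\mathbb{N}$ ($j\in V_2$), and let $X\subseteq \mathbb{R}^{|E|}_{+}\times\{0,1\}^{|V_2|}$ be its set of feasible solutions. Let $k\in\mathbb{Z}_{+}$ with $k\le |V_2|$, and let $$X^k := \mathrm{conv}\Big(X\cap\Big\{(x,z)\in\mathbb{R}^{|E|}_{+}\times\{0,1\}^{|V_2|} \;\Big|\; \sum_{j\in V_2} z_j\le k\Big\}\Big).$$ If $d_j\le 2$ for all $j\in V_2$, then $$X^k=\mathrm{conv}(X)\cap\Big\{(x,z)\in\mathbb{R}^{|E|}_{+}\times[0,1]^{|V_2|} \;\Big|\; \sum_{j\in V_2} z_j\le k\Big\}.$$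
   Context: An instance of TPMC has a finite bipartite graph $G(V_1\cup V_2,E)$, where $V_1$ is the set of supply nodes, $V_2$ is the set of demand nodes (markets), and every edge is written $(i,j)\in E$ with $i\in V_1$, $j\in V_2$. Each $i\in V_1$ has a capacity $s_i\in\mathbb{N}$ and each $j\in V_2$ has a demand $d_j\in\mathbb{N}$, where $\mathbb{N}$ denotes the positive integers. The set $X$ of feasible solutions consists of all $(x,z)\in\mathbb{R}^{|E|}_{+}\times\{0,1\}^{|V_2|}$ such that $$\sum_{i:(i,j)\in E}x_{ij}=d_j(1-z_j)\quad\text{for all } j\in V_2,\qquad \sum_{j:(i,j)\in E}x_{ij}\le s_i\quad\text{for all } i\in V_1.$$ Here $x_{ij}$ is the amount shipped from supplier $i$ to market $j$, and $z_j=1$ means market $j$ is rejected. $\mathbb{R}_+$ denotes the nonnegative reals, $\mathbb{Z}_+$ the nonnegative integers, and $\mathrm{conv}$ the convex hull. *)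

(* Defs.v *)
From mathcomp Require Import all_boot all_order all_algebra.
From mathcomp Require Import boolp classical_sets reals convex.

Set Implicit Arguments.
Unset Strict Implicit.
Unset Printing Implicit Defensive.

Import Order.TTheory GRing.Theory Num.Theory.
Local Open Scope classical_set_scope.
Local Open Scope ring_scope.

Definition convex_hull (R : numDomainType) (M : lmodType R) (A : set M) :
    set M :=
  smallest (@convex_set R M) A.

Section TPMC.
Variables (R : realType) (V1 V2 : finType) (E : {set V1 * V2}).

Definition edge : finType := {e : V1 * V2 | e \in E}.

(* R^|E| x R^|V2|; R^o is R viewed as a module over itself, which is what gives
   the product its lmodType structure. *)
Local Notation tpmc_space := ({ffun edge -> R^o} * {ffun V2 -> R^o})%type.

Definition ship (p : tpmc_space) (e : edge) : R := p.1 e.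

Definition reject (p : tpmc_space) (j : V2) : R := p.2 j.

Definition nonneg_binary : set tpmc_space :=
  [set p | (forall e, 0 <= ship p e) /\
           (forall j, reject p j = 0 \/ reject p j = 1)].

Definition nonneg_unit : set tpmc_space :=
  [set p | (forall e, 0 <= ship p e) /\ (forall j, 0 <= reject p j <= 1)].

Definition at_most_rejected (k : nat) : set tpmc_space :=
  [set p | \sum_(j : V2) reject p j <= k%:R].

Definition tpmc_feasible (s : V1 -> nat) (d : V2 -> nat) : set tpmc_space :=
  nonneg_binary `&`
  [set p | (forall j, \sum_(e : edge | (val e).2 == j) ship p e
                        = (d j)%:R * (1 - reject p j)) /\
           (forall i, \sum_(e : edge | (val e).1 == i) ship p e <= (s i)%:R)].

End TPMC.

Arguments nonneg_binary {R V1 V2 E}.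
Arguments nonneg_unit {R V1 V2 E}.
Arguments at_most_rejected {R V1 V2 E} k.
Arguments tpmc_feasible R {V1 V2} E s d.

(* Main.v *)
Require Import Defs.
From mathcomp Require Import all_boot all_order all_algebra.
From mathcomp Require Import zify ring.

(** Why the theorem holds. Only the inclusion of the right-hand side in [X^k]
    is not immediate. Slice the feasible set by the number [m] of rejected
    markets, keeping only integral shipments: this is [layer m]. Two facts about
    the layers suffice.

    - Every feasible point with [m] rejections is in the convex hull of [layer m]
      ([feasible_layer]). With the rejections fixed, the shipments form a
      transportation polytope with integral data, and such a polytope is the hull
      of its integral points. The argument is rounding: if some shipments are
      fractional, a circulation supported on the fractional edges
      ([circulation]) can be added in either direction until one more quantity
      becomes integral ([rounding_step]).

    - If [u] is in layer [a] and [v] in layer [b] with [a + 2 <= b], then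
      [u + v = u' + v'] with [u'] in layer [a + 1] and [v'] in layer [b - 1]
      ([layer_exchange]). This is where [d_j <= 2] enters.

    By the second fact, weight on two far layers can be traded for weight on
    layers closer to each other, until a given point of [conv X] is a mixture of
    points of two consecutive hulls, those of layers [c] and [c + 1]
    ([hull_consecutive]). The number of rejections is an affine function equal to
    [m] on layer [m], so its value at the mixture lies between [c] and [c + 1].
    If it is at most [k], every layer with positive weight is at most [k].

    The exchange is combinatorial. Cut the two integral shipments into unit
    tokens, each with a supplier, a market and a colour telling whether it belongs
    to [u] or [v]; exchanging means recolouring some tokens. At each supplier pair
    tokens of opposite colours as long as possible. At a market treated alike by
    [u] and [v] pair all tokens with opposite colours; at a market accepted by
    exactly one of them there are one or two tokens, and if two, pair them with
    each other. Flipping the colours in a set of tokens closed under both pairings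
    gives feasible solutions again: markets of the last kind switch as a whole,
    and the suppliers stay within capacity. Following the two pairings
    alternately, the tokens fall apart into paths and cycles, so that a component
    has at most two unpaired ends ([orbit_fixed_points]). Summing signs of colours
    over a component in two ways shows that flipping it changes the number of
    rejections by half the signed number of its ends, hence by at most one. The
    changes over all components add up to [b - a], which is positive, so some
    component changes the number by exactly one. *)

Import Order.TTheory GRing.Theory Num.Theory.
Local Open Scope ring_scope.

(** * Components of a pair of involutions *)

Section TwoInvolutions.
Set Implicit Arguments.
Unset Strict Implicit.
Variable T : finType.

Definition closed_under (f : T -> T) (A : {set T}) := [forall x in A, f x \in A].

Lemma closed_underP f (A : {set T}) :
  reflect (forall x, x \in A -> f x \in A) (closed_under f A).
Proof. exact: forall_inP. Qed.

Lemma iter_fixed_dvdn (f : T -> T) x n : injective f ->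
  iter n f x = x -> (order f x %| n)%N.
Proof.
move=> injf fnx; rewrite /dvdn; apply/eqP.
have mP : (n %% order f x < order f x)%N by rewrite ltn_mod order_gt0.
have mulP q : iter (q * order f x) f x = x.
  by elim: q => // q IHq; rewrite mulSn iterD IHq iter_order.
suff fmx : iter (n %% order f x) f x = x by rewrite -(findex_iter mP) fmx findex0.
by rewrite -[RHS]fnx [in RHS](divn_eq n (order f x)) addnC iterD mulP.
Qed.

(** The component of a fixed point of [s] is its orbit under [f = m \o s]. On the
    orbit, of length [n], the involutions act as the reflections [k |-> -k] and
    [k |-> 1 - k] of the cycle of residues modulo [n], which have two fixed
    points between them: [2 k = 0] and [2 k = 1] modulo [n]. *)
Lemma orbit_fixed_points (s m : T -> T) (t : T) :
    involutive s -> involutive m -> s t = t ->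
  exists B : {set T}, [/\ t \in B, closed_under s B, closed_under m B &
    (#|[set x in B | s x == x]| + #|[set x in B | m x == x]| <= 2)%N].
Proof.
move=> ss mm st; pose f := m \o s.
have injf : injective f by apply: inj_comp; apply: inv_inj.
have fsf x : f (s (f x)) = s x by rewrite /f /= ss mm.
have fsfn k x : iter k f (s (iter k f x)) = s x.
  by elim: k x => // k IHk x; rewrite iterS iterSr IHk fsf.
pose B := [set y | fconnect f t y]; set n := order f t.
have n_gt0 : (0 < n)%N by exact: order_gt0.
have BP x : x \in B -> exists2 k, (k < n)%N & x = iter k f t.
  rewrite inE => tx; exists (findex f t x); first exact: findex_max.
  by rewrite iter_findex.
have sB x : x \in B -> s x \in B.
  case/BP => k kn ->; rewrite inE fconnect_sym //.
  by rewrite -[X in fconnect _ _ X]st -(fsfn k t) fconnect_iter.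
have fB x : x \in B -> f x \in B.
  by rewrite !inE => tx; apply: connect_trans tx (fconnect1 _ _).
have mB x : x \in B -> m x \in B.
  by move=> xB; rewrite -[x]ss; apply/fB/sB.
exists B; split; [by rewrite inE connect0 | exact/closed_underP
                 | exact/closed_underP |].
have sfix k : s (iter k f t) = iter k f t -> (n %| k + k)%N.
  by move=> sk; apply: iter_fixed_dvdn => //; rewrite iterD -{1}sk fsfn.
have mfix k : m (iter k f t) = iter k f t -> (n %| k + k + n.-1)%N.
  move=> mk; apply: iter_fixed_dvdn => //; apply: (injf).
  rewrite -iterS -addnS prednK // iterD (iter_order injf) iterD -{1}mk.
  have -> : m (iter k f t) = f (s (iter k f t)) by rewrite /f /= ss.
  by rewrite -iterSr iterS fsfn st.
have kP k : (k < n)%N -> (n %| k + k)%N -> k = 0 \/ (k = n./2 /\ ~~ odd n).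
  by move=> kn /dvdnP[[|[|q]]] eqk; nia.
(* The reduction modulo [n] matters only for [n = 1], where [k = 0]. *)
have kQ k : (k < n)%N -> (n %| k + k + n.-1)%N ->
    (k = n.+1./2 %% n)%N /\ odd n.
  move=> kn /dvdnP[[|[|[|q]]]] eqk; [|nia| |nia].
    have n1 : n = 1 by lia.
    by rewrite n1; split=> //; lia.
  have k_def : k = n.+1./2 by lia.
  by rewrite -k_def modn_small //; split=> //; lia.
have sub_s : [set x in B | s x == x] \subset
    [set t; if odd n then t else iter n./2 f t].
  apply/subsetP => x; rewrite !inE -[fconnect _ _ _]in_set => /andP[].
  by case/BP => k kn -> /eqP/sfix /(kP _ kn)[->|[-> /negPf->]];
    rewrite eqxx ?orbT.
have sub_m : [set x in B | m x == x] \subset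
    (if odd n then [set iter (n.+1./2 %% n)%N f t] else set0).
  apply/subsetP => x; rewrite inE => /andP[].
  by case/BP => k kn -> /eqP/mfix /(kQ _ kn)[-> ->]; rewrite inE.
have := leq_add (subset_leq_card sub_s) (subset_leq_card sub_m).
move/leq_trans; apply; case: (odd n).
  by rewrite setUid !cards1.
by rewrite cards0 addn0 cards2; case: eqP.
Qed.

(** A matching is encoded as an involution whose fixed points are the unmatched
    elements; one with the fewest fixed points is maximal, since two related
    fixed points could be matched with each other. *)
Lemma maximal_matching (r : rel T) : symmetric r ->
  exists s : T -> T, [/\ involutive s, forall x, s x != x -> r x (s x) &
    forall x y, x != y -> s x = x -> s y = y -> ~~ r x y].
Proof.
move=> r_sym.
pose P := [pred s : {ffun T -> T} |
  [forall x, (s (s x) == x) && ((s x != x) ==> r x (s x))]].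
have P0 : P [ffun x => x] by apply/forallP => x; rewrite !ffunE eqxx.
case: (@arg_maxnP _ _ P (fun s : {ffun T -> T} => #|[pred x | s x != x]|) P0).
move=> s /forallP Ps s_max.
have ss x : s (s x) = x by have /andP[/eqP] := Ps x.
have sr x : s x != x -> r x (s x) by have /andP[_ /implyP] := Ps x.
exists s; split => // x y xy sx sy; apply/negP => rxy.
pose s' := [ffun z => if z == x then y else if z == y then x else s z].
have s'x : s' x = y by rewrite ffunE eqxx.
have s'y : s' y = x by rewrite ffunE eqxx; case: eqP.
have s'z z : z != x -> z != y -> s' z = s z.
  by rewrite ffunE => /negPf-> /negPf->.
have Ps' : P s'.
  apply/forallP => z; have [->|zx] := eqVneq z x.
    by rewrite s'x s'y eqxx rxy implybT.
  have [->|zy] := eqVneq z y; first by rewrite s'y s'x eqxx r_sym rxy implybT.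
  have szx : s z != x by apply: contra_neq zx => szx; rewrite -[z]ss szx.
  have szy : s z != y by apply: contra_neq zy => szy; rewrite -[z]ss szy.
  by rewrite (s'z z) // (s'z (s z)) // ss eqxx; apply/implyP/sr.
have := s_max _ Ps'; rewrite /= leqNgt => /negP; apply; apply/proper_card/properP.
split; last by exists x; rewrite !inE ?s'x ?sx ?eqxx // eq_sym.
apply/subsetP => z; rewrite !inE.
have [->|zx] := eqVneq z x; first by rewrite sx eqxx.
by have [->|zy] := eqVneq z y; [rewrite sy eqxx | rewrite s'z].
Qed.

(** The weighted number of ends of the paths that make up [A]: a point fixed by
    both involutions is a path of length zero and counts twice. *)
Definition fixed_sum (s m : T -> T) (w : T -> int) (A : {set T}) : int :=
  \sum_(x in A | s x == x) w x + \sum_(x in A | m x == x) w x.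

Lemma fixed_sum_setID s m w (A B : {set T}) :
  fixed_sum s m w A = fixed_sum s m w (A :&: B) + fixed_sum s m w (A :\: B).
Proof.
rewrite /fixed_sum addrACA; congr (_ + _).
  by rewrite (bigID (mem B)) /=; congr (_ + _); apply: eq_bigl => x;
    rewrite !inE; do !case: (_ \in _); rewrite ?andbT ?andbF.
by rewrite (bigID (mem B)) /=; congr (_ + _); apply: eq_bigl => x;
  rewrite !inE; do !case: (_ \in _); rewrite ?andbT ?andbF.
Qed.

Lemma closed_underI f (A B : {set T}) :
  closed_under f A -> closed_under f B -> closed_under f (A :&: B).
Proof.
move=> /closed_underP fA /closed_underP fB; apply/closed_underP => x.
by rewrite !inE => /andP[/fA-> /fB->].
Qed.

Lemma closed_underD f (A B : {set T}) : involutive f ->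
  closed_under f A -> closed_under f B -> closed_under f (A :\: B).
Proof.
move=> ff /closed_underP fA /closed_underP fB; apply/closed_underP => x.
rewrite !inE => /andP[xB /fA->]; rewrite andbT.
by apply: contra xB => /fB; rewrite ff.
Qed.

(** A minimal closed set with positive fixed sum is a single component: otherwise
    it would split into two closed sets, one of which still has a positive sum.
    A component has at most two ends, each contributing at most 1. *)
Lemma exists_small_component (s m : T -> T) (w : T -> int) :
    involutive s -> involutive m -> (forall x, w x <= 1) ->
    0 < fixed_sum s m w [set: T] ->
  exists A, [/\ closed_under s A, closed_under m A & 0 < fixed_sum s m w A <= 2].
Proof.
move=> ss mm w1 valT.
pose P := [pred A : {set T} |
  [&& closed_under s A, closed_under m A & 0 < fixed_sum s m w A]].
have PT : P [set: T].
  rewrite /= valT andbT.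
  by apply/andP; split; apply/closed_underP => x; rewrite !inE.
case: (@arg_minnP _ _ P (fun A : {set T} => #|A|) PT).
move=> A /and3P[sA mA A_gt0] A_min.
exists A; split => //; rewrite A_gt0 /=.
have bound (B : {set T}) t : t \in A -> t \in B -> closed_under s B ->
    closed_under m B ->
    (#|[set x in B | s x == x]| + #|[set x in B | m x == x]| <= 2)%N ->
  fixed_sum s m w A <= 2.
  move=> tA tB sB mB B2.
  have AB : A \subset B.
    apply: contraLR A_gt0 => nAB; rewrite -leNgt (fixed_sum_setID _ _ _ _ B).
    have small (C : {set T}) : closed_under s C -> closed_under m C ->
        C \proper A -> fixed_sum s m w C <= 0.
      move=> sC mC CA; rewrite leNgt; apply/negP => C_gt0.
      have := A_min C; rewrite /= sC mC C_gt0 => /(_ isT).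
      by rewrite leqNgt proper_card.
    rewrite -[leRHS]addr0 lerD // small ?closed_underI ?closed_underD //.
      rewrite properEneq subsetIl andbT; apply: contraNneq nAB => <-.
      exact: subsetIr.
    rewrite properE subsetDl; apply/subsetPn; exists t => //.
    by rewrite !inE tB.
  have le_card (p : pred T) : \sum_(x in A | p x) w x <= #|[set x in B | p x]|%:R.
    apply: le_trans (ler_sum _ (fun x _ => w1 x)) _.
    rewrite sumr_const ler_nat -cardsE; apply/subset_leq_card/subsetP => x.
    by rewrite !inE => /andP[/(subsetP AB)-> ->].
  apply: le_trans (lerD (le_card _) (le_card _)) _.
  by rewrite -natrD ler_nat.
have [/pred0P nfix|/pred0Pn[t]] :=
    boolP (pred0b [pred x | (x \in A) && ((s x == x) || (m x == x))]).
  move: A_gt0; rewrite /fixed_sum !big_pred0 ?addr0 ?ltxx // => x;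
    have /= := nfix x.
    by case: (x \in A); case: (s x == x).
  by case: (x \in A); case: (s x == x).
case/andP => tA /orP[] /eqP fixt.
  by have [B [tB sB mB]] := orbit_fixed_points ss mm fixt; apply: (bound B t).
have [B [tB mB sB B2]] := orbit_fixed_points mm ss fixt.
by apply: (bound B t) => //; rewrite addnC.
Qed.

End TwoInvolutions.

(** * Exchanging a rejection between two integral solutions *)

Section TokenExchange.
Set Implicit Arguments.
Unset Strict Implicit.

Lemma sum_involution_eq0 (T : finType) (P : pred T) (f : T -> T) (w : T -> int) :
    involutive f -> (forall x, P x -> P (f x)) ->
    (forall x, P x -> w (f x) = - w x) ->
  \sum_(x | P x) w x = 0.
Proof.
move=> ff Pf wf; have PE x : P (f x) = P x.
  by apply/idP/idP => /Pf; rewrite ?ff.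
suff : \sum_(x | P x) w x = - \sum_(x | P x) w x by lia.
rewrite {1}(reindex_inj (inv_inj ff)) /= -sumrN.
by rewrite (eq_bigl _ _ PE); apply: eq_bigr => x /wf.
Qed.

Variables (V1 V2 : finType) (s : V1 -> nat) (d : V2 -> nat).

(** Two integral solutions at once, indexed by a colour: the tokens of colour [b]
    are the units shipped in solution [b], and [z b] is its set of rejected
    markets. *)
Definition tokens_feasible (T : finType) (sup : T -> V1) (mkt : T -> V2)
    (col : T -> bool) (z : bool -> V2 -> bool) :=
  (forall b j, #|[set t | mkt t == j & col t == b]| = d j * ~~ z b j)%N /\
  (forall b i, #|[set t | sup t == i & col t == b]| <= s i)%N.

(** The pairing [sg] acts at the suppliers and [mu] at the markets. A market is
    special if exactly one of the two solutions accepts it. Only at special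
    markets may [mu] pair tokens of the same colour, and only there can it leave
    a token unpaired. *)
Lemma token_exchange (T : finType) (sup : T -> V1) (mkt : T -> V2)
    (col : T -> bool) (z : bool -> V2 -> bool) :
    (forall j, (0 < d j <= 2)%N) -> tokens_feasible sup mkt col z ->
    ((\sum_j z true j).+2 <= \sum_j z false j)%N ->
  exists col' z', [/\ tokens_feasible sup mkt col' z',
    forall j, (z' true j + z' false j = z true j + z false j)%N &
    (\sum_j z' true j = (\sum_j z true j).+1)%N].
Proof.
move=> d12 [dem cap] gap.
pose special j := z true j != z false j.
have token_rej t : z (col t) (mkt t) = false.
  apply/negP => zt; have := dem (col t) (mkt t).
  rewrite zt muln0 => /eqP; rewrite cards_eq0 => /eqP/setP/(_ t).
  by rewrite !inE !eqxx.
have special_col t u : special (mkt t) -> mkt u = mkt t -> col u = col t.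
  move=> spt ut; have := token_rej t; have := token_rej u; move: spt.
  rewrite ut /special.
  by case: (col t) (col u) => [] [] // + zu zt; rewrite zu zt.
have [sg [sgK sg_r sg_max]] := @maximal_matching T
  (fun t u => (sup t == sup u) && (col t != col u))
  (fun t u => congr2 andb (eq_sym _ _) (congr1 negb (eq_sym _ _))).
have [|mu [muK mu_r mu_max]] := @maximal_matching T
  (fun t u => (mkt t == mkt u) && (special (mkt t) || (col t != col u))).
  by move=> t u; rewrite eq_sym; case: eqP => //= ->; rewrite eq_sym.
have sup_sg t : sup (sg t) = sup t.
  by have [->//|/sg_r/andP[/eqP<-]] := eqVneq (sg t) t.
have col_sg t : sg t != t -> col (sg t) = ~~ col t.
  by move/sg_r => /andP[_]; case: (col t); case: (col (sg t)).
have mkt_mu t : mkt (mu t) = mkt t.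
  by have [->//|/mu_r/andP[/eqP<-]] := eqVneq (mu t) t.
(* A special market has at most two tokens, and a maximal pairing matches them if
   there are two. *)
have mu_special t u : special (mkt t) -> mkt u = mkt t -> u = t \/ u = mu t.
  move=> spt ut; have [->|nut] := eqVneq u t; [by left | right].
  have only v : mkt v = mkt t -> v \in [set t; u].
    move=> vt; apply: contraLR isT => nv.
    have : (#|[set v; t; u]| <= 2)%N.
      apply: leq_trans (_ : d (mkt t) * ~~ z (col t) (mkt t) <= 2)%N.
        rewrite -dem; apply/subset_leq_card/subsetP => x; rewrite !inE.
        by case/orP => [/orP[]|] /eqP ->; rewrite ?vt ?ut ?(special_col t) ?eqxx.
      by have /andP[_] := d12 (mkt t); case: (z _ _); rewrite ?muln0 ?muln1.
    by rewrite -setUA cardsU1 nv cards2 eq_sym nut.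
  have := only (mu t) (mkt_mu t); rewrite !inE => /orP[]/eqP mut //.
  have := only (mu u); rewrite mkt_mu !inE => /(_ ut) /orP[]/eqP muu.
    by move: nut; rewrite -[u]muK muu mut eqxx.
  have := mu_max _ _ nut muu mut.
  by rewrite ut eqxx spt.
(* At any other market both colours occur equally often, so that a maximal
   pairing of opposite colours is perfect. *)
have mu_plain t : ~~ special (mkt t) -> mu t != t /\ col (mu t) = ~~ col t.
  move=> nsp; have col_mu u : ~~ special (mkt u) -> mu u != u ->
      col (mu u) = ~~ col u.
    by move=> nspu /mu_r /andP[_]; rewrite (negPf nspu) /=;
      case: (col u); case: (col (mu u)).
  suff mut : mu t != t by split=> //; apply: col_mu.
  apply/eqP => mut.
  pose S b := [set u | mkt u == mkt t & col u == b].
  have : (#|S (~~ col t)| < #|S (col t)|)%N.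
    have <- : #|[set mu u | u in S (~~ col t)]| = #|S (~~ col t)|.
      by apply: card_imset; apply: inv_inj.
    apply/proper_card/properP; split.
      apply/subsetP => _ /imsetP[u uS ->]; move: uS; rewrite !inE mkt_mu.
      move=> /andP[/eqP ut /eqP ucol]; rewrite ut eqxx /= col_mu ?ut //.
        by rewrite ucol negbK.
      apply/eqP => muu.
      have tu : t != u by apply: contraPneq ucol => <-; case: (col t).
      have := mu_max _ _ tu mut muu.
      by rewrite ut eqxx ucol /= orbC; case: (col t).
    exists t; first by rewrite !inE !eqxx.
    apply/imsetP => -[u]; rewrite inE => /andP[_ /eqP ucol] tmu.
    by move: ucol; rewrite -[u]muK -tmu mut; case: (col t).
  rewrite !dem; move: nsp; rewrite negbK.
  by case: (col t) => /= /eqP ->; rewrite ltnn.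
pose hit (A : {set T}) j := [exists t in A, mkt t == j].
pose sgn t : int := if col t then 1 else -1.
have sgnN t u : col u = ~~ col t -> sgn u = - sgn t.
  by rewrite /sgn => ->; case: (col t).
(* Pairs of [sg] have opposite signs, so the sum over [sg]-fixed tokens is the sum
   of all signs in [A]. Sorted by market, the tokens at a special market then
   contribute [2 sgn]: one token counted also as [mu]-fixed, or two equal signs. *)
have hit_sum (A : {set T}) : closed_under sg A -> closed_under mu A ->
    fixed_sum sg mu sgn A =
    2 * \sum_(j | hit A j) ((z false j)%:R - (z true j)%:R).
  move=> /closed_underP sgA /closed_underP muA.
  have -> : fixed_sum sg mu sgn A =
      \sum_(t in A) (sgn t + if mu t == t then sgn t else 0).
    rewrite big_split -big_mkcondr /fixed_sum /=; congr (_ + _).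
    rewrite [RHS](bigID (fun t => sg t == t)) /=.
    rewrite [X in _ + X](sum_involution_eq0 sgK) ?addr0 //.
    - by move=> t /andP[/sgA-> sgt]; rewrite sgK eq_sym.
    - by move=> t /andP[_ /col_sg]; apply: sgnN.
  rewrite (partition_big mkt (hit A)) /=; last first.
    by move=> t tA; apply/existsP; exists t; rewrite tA eqxx.
  rewrite mulr_sumr; apply: eq_bigr => j /existsP[t /andP[tA /eqP tj]].
  have [spt|nsp] := boolP (special (mkt t)).
    have -> : (z false j)%:R - (z true j)%:R = sgn t :> int.
      have := token_rej t; move: spt; rewrite /special tj /sgn.
      by case: (col t) => + zj; rewrite zj; case: (z _ j) => //;
        rewrite ?subr0 ?sub0r.
    have only u : (u \in A) && (mkt u == j) = (u == t) || (u == mu t).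
      apply/idP/idP => [/andP[_ /eqP uj]|/orP[]/eqP->].
      - have [->|->] := mu_special t u spt (etrans uj (esym tj));
          by rewrite eqxx ?orbT.
      - by rewrite tA tj eqxx.
      - by rewrite muA // mkt_mu tj eqxx.
    rewrite (eq_bigl _ _ only); have [mut|mut] := eqVneq (mu t) t.
      rewrite mut (big_pred1 t) ?mut ?eqxx ?mulrDl ?mul1r // => u.
      by rewrite /= orbb.
    rewrite (bigD1 t) ?eqxx //= (big_pred1 (mu t)) => [|u /=].
      rewrite muK (negPf mut) eq_sym (negPf mut) !addr0.
      by rewrite /sgn (special_col t (mu t)) // mulrDl mul1r.
    by have [->|] := eqVneq u t; rewrite ?andbT ?andbF // eq_sym (negPf mut).
  rewrite (_ : z false j = z true j) ?subrr ?mulr0; last first.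
    by apply/eqP; rewrite eq_sym -tj -[_ == _]negbK.
  have plain u : (u \in A) && (mkt u == j) -> mu u != u /\ col (mu u) = ~~ col u.
    by case/andP => _ /eqP uj; apply: mu_plain; rewrite uj -tj.
  apply: (sum_involution_eq0 muK) => [u /andP[/muA-> ]|u uP].
    by rewrite mkt_mu.
  have [muu colu] := plain u uP.
  by rewrite muK eq_sym (negPf muu) !addr0; apply: sgnN.
pose gain (A : {set T}) : int :=
  \sum_(j | hit A j) ((z false j)%:R - (z true j)%:R).
have gainT : gain [set: T] = (\sum_j z false j)%:R - (\sum_j z true j)%:R.
  rewrite !natr_sum -sumrB /gain big_mkcond /=; apply: eq_bigr => j _.
  case: ifPn => // /existsPn nhit.
  (* A market without tokens is rejected in both solutions, as [d j > 0]. *)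
  have zj b : z b j = true.
    have /eqP := dem b j; rewrite (_ : [set _ | _] = set0) ?cards0.
      have /andP[d_gt0 _] := d12 j.
      by rewrite eq_sym muln_eq0 -leqn0 leqNgt d_gt0 /= eqb0 negbK.
    by apply/setP => t; have := nhit t; rewrite !inE /= => /negPf->.
  by rewrite !zj subrr.
have [||A [sgA muA]] := @exists_small_component T sg mu sgn sgK muK.
- by move=> t; rewrite /sgn; case: ifP.
- rewrite hit_sum ?[X in 2 * X]gainT; last 2 first.
  + by apply/closed_underP.
  + by apply/closed_underP.
  lia.
rewrite hit_sum // -[X in 2 * X]/(gain A) => gainA.
have {}gainA : gain A = 1 by lia.
pose col' t := col t (+) (t \in A).
pose z' b j := z (b (+) hit A j) j.
move/closed_underP in sgA; move/closed_underP in muA.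
have special_hit t : special (mkt t) -> (t \in A) = hit A (mkt t).
  move=> spt; apply/idP/existsP => [tA|[u /andP[uA /eqP ut]]].
    by exists t; rewrite tA eqxx.
  have [->//|->] : t = u \/ t = mu u by apply: mu_special; rewrite ut.
  exact: muA.
exists col', z'; split; first split.
- move=> b j; have [spj|nspj] := boolP (special j).
    rewrite -dem; apply: eq_card => t; rewrite !inE.
    have [tj|//] := eqVneq (mkt t) j.
    rewrite /col' special_hit ?tj //=.
    by case: (hit A j) (col t) b => [] [] [].
  have -> : z' b j = z b j.
    by move: nspj; rewrite negbK /z' => /eqP; case: b (hit A j) => [] [].
  pose f t := if t \in A then mu t else t.
  have muAE t : (mu t \in A) = (t \in A).
    by apply/idP/idP => /muA; rewrite ?muK.
  have fK : involutive f.
    move=> t; rewrite /f; have [tA|tA] := boolP (t \in A).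
      by rewrite muAE tA muK.
    by rewrite (negPf tA).
  have mkt_f t : mkt (f t) = mkt t by rewrite /f; case: ifP.
  rewrite -dem -[RHS](card_preimset _ (inv_inj fK)).
  apply: eq_card => t; rewrite !inE mkt_f; case: eqP => //= tj.
  rewrite /col' /f; case: ifP => _; last by rewrite addbF.
  by have [|_ ->] := mu_plain t; rewrite ?tj // addbT.
- move=> b i.
  (* The unpaired tokens at [i] have a common colour [c]. As [c] is the majority
     colour, both flipped colour classes inject into the old class of [c]. *)
  have [c cP] : exists c, forall t, sup t = i -> sg t = t -> col t = c.
    have [/existsP[t /and3P[/eqP ti /eqP sgt colt]]|/existsPn nofix] :=
      boolP [exists t, [&& sup t == i, sg t == t & col t]].
      exists true => u ui sgu; have [->|tu] := eqVneq u t; first by [].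
      by have := sg_max _ _ tu sgu sgt; rewrite ui ti eqxx colt; case: (col u).
    exists false => u ui sgu; have := nofix u.
    by rewrite ui sgu !eqxx; case: (col u).
  pose f t := if (t \in A) == (b == c) then sg t else t.
  have sgAE t : (sg t \in A) = (t \in A).
    by apply/idP/idP => /sgA; rewrite ?sgK.
  have fK : involutive f.
    move=> t; rewrite /f; have [tA|tA] := boolP ((t \in A) == (b == c)).
      by rewrite sgAE tA sgK.
    by rewrite (negPf tA).
  apply: leq_trans (cap c i); rewrite -[leqRHS](card_preimset _ (inv_inj fK)).
  apply/subset_leq_card/subsetP => t; rewrite !inE => /andP[/eqP ti].
  have -> : sup (f t) = i by rewrite /f; case: ifP => _; rewrite ?sup_sg.
  rewrite eqxx /= /col' /f => /eqP tb.
  have [sgt|/col_sg sgt] := eqVneq (sg t) t.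
    by rewrite sgt if_same (cP t ti sgt).
  rewrite -tb; case: ifP; rewrite ?sgt.
    by case: (t \in A); case: (col t); case: (c).
  by case: (t \in A); case: (col t); case: (c).
- by move=> j; rewrite /z'; case: (hit A j) => /=; [rewrite addnC|].
- suff : (\sum_j z' true j)%:R = (\sum_j z true j)%:R + gain A :> int by lia.
  rewrite !natr_sum /gain [X in _ + X]big_mkcond -big_split /=.
  apply: eq_bigr => j _.
  by rewrite /z'; case: (hit A j); rewrite ?addr0 //= addrC subrK.
Qed.
End TokenExchange.

Section FlowExchange.
Set Implicit Arguments.
Unset Strict Implicit.
Variables (V1 V2 E : finType) (sup : E -> V1) (mkt : E -> V2).
Variables (s : V1 -> nat) (d : V2 -> nat).

Definition flow_feasible (n : E -> nat) (z : V2 -> bool) :=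
  (forall j, \sum_(e | mkt e == j) n e = d j * ~~ z j)%N /\
  (forall i, \sum_(e | sup e == i) n e <= s i)%N.

(** Number the tokens of the two flows edge by edge; a recoloured token is shipped
    along its old edge. *)
Lemma flow_exchange (n : bool -> E -> nat) (z : bool -> V2 -> bool) :
    (forall j, (0 < d j <= 2)%N) -> (forall b, flow_feasible (n b) (z b)) ->
    ((\sum_j z true j).+2 <= \sum_j z false j)%N ->
  exists n' z', [/\ forall b, flow_feasible (n' b) (z' b),
    forall e, (n' true e + n' false e = n true e + n false e)%N,
    forall j, (z' true j + z' false j = z true j + z false j)%N &
    (\sum_j z' true j = (\sum_j z true j).+1)%N].
Proof.
move=> d12 feas gap.
pose T : finType := {be : bool * E & 'I_(n be.1 be.2)}.
pose edg (t : T) := (tag t).2; pose col (t : T) := (tag t).1.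
have card_tokens (Q : pred (bool * E)) :
    #|[set t : T | Q (tag t)]| = (\sum_(be | Q be) n be.1 be.2)%N.
  rewrite -sum1_card (eq_bigl (fun t : T => Q (tag t) && true)); last first.
    by move=> t; rewrite inE andbT.
  rewrite -(sig_big_dep Q (fun _ _ => true) (fun _ _ => 1%N)).
  by apply: eq_bigr => be _; rewrite sum1_card card_ord.
have card_col (Q : pred E) b :
    #|[set t : T | Q (edg t) & col t == b]| = (\sum_(e | Q e) n b e)%N.
  rewrite (card_tokens (fun be => Q be.2 && (be.1 == b))).
  rewrite (eq_bigl (fun be => (be.1 == b) && Q be.2)) => [|be]; last exact: andbC.
  rewrite -(pair_big_dep (eq_op^~ b) (fun _ => Q) (fun b e => n b e)).
  by rewrite big_pred1_eq.
have [|col' [z' [[dem cap] zE count]]] :=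
  @token_exchange V1 V2 s d T (sup \o edg) (mkt \o edg) col z d12 _ gap.
  split=> [b j|b i].
    by rewrite (card_col (fun e => mkt e == j)); have [->] := feas b.
  by rewrite (card_col (fun e => sup e == i)); have [_ ->] := feas b.
pose n' b e := #|[set t : T | edg t == e & col' t == b]|.
have sum_n' (Q : pred E) b :
    (\sum_(e | Q e) n' b e)%N = #|[set t : T | Q (edg t) & col' t == b]|.
  rewrite -[RHS]sum1_card (partition_big edg Q) => [|t]; last first.
    by rewrite inE => /andP[].
  apply: eq_bigr => e Qe; rewrite /n' -sum1_card; apply: eq_bigl => t.
  by rewrite !inE; case: eqP => [->|]; rewrite ?Qe ?andbT ?andbF.
exists n', z'; split=> // [b|e].
  by split=> [j|i]; rewrite sum_n'; [apply: dem | apply: cap].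
transitivity #|[set t : T | edg t == e]|.
  rewrite -[RHS](cardsID [set t | col' t]); congr addn; apply: eq_card => t.
    by rewrite !inE eqb_id.
  by rewrite !inE andbC eqbF_neg.
rewrite -[LHS](cardsID [set t | col t]).
rewrite -[n true e](big_pred1_eq addn e) -[n false e](big_pred1_eq addn e).
rewrite -!card_col; congr addn; apply: eq_card => t; rewrite !inE ?eqb_id //.
by rewrite andbC eqbF_neg.
Qed.
End FlowExchange.

(** * Rounding fractional flows *)

Section Rounding.
Set Implicit Arguments.
Unset Strict Implicit.
Variable R : archiRealFieldType.

(** Fewer homogeneous equations than unknowns; the unknowns outside [A] are set
    to 0. *)
Lemma kernel_vector (T N : finType) (A : {set T}) (C : {set N})
    (L : N -> T -> R) :
    (#|C| < #|A|)%N ->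
  exists h : T -> R, [/\ exists t, h t != 0, forall t, t \notin A -> h t = 0 &
    forall c, c \in C -> \sum_t h t * L c t = 0].
Proof.
move=> CA.
pose M : 'M[R]_(#|A|, #|C|) := \matrix_(i, j) L (enum_val j) (enum_val i).
have : kermx M != 0.
  rewrite -mxrank_eq0 mxrank_ker -lt0n subn_gt0.
  exact: leq_ltn_trans (rank_leq_col M) CA.
case/rowV0Pn => u /sub_kermxP uM u0.
pose h t := \sum_(i < #|A| | enum_val i == t) u 0 i.
have h_val i : h (enum_val i) = u 0 i.
  by rewrite /h (big_pred1 i) // => k; rewrite /= (inj_eq enum_val_inj).
exists h; split.
- have /rV0Pn[i ui] := u0.
  by exists (enum_val i); rewrite h_val.
- move=> t tA; rewrite /h big_pred0 // => i.
  by apply: contraNF tA => /eqP <-; apply: enum_valP.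
- move=> c cC; have /matrixP/(_ 0 (enum_rank_in cC c)) := uM.
  rewrite !mxE => uMc; apply: etrans uMc; symmetry.
  rewrite (partition_big (fun i : 'I_#|A| => enum_val i) predT) //=.
  apply: eq_bigr => t _; rewrite mulr_suml; apply: eq_bigr => i /eqP <-.
  by rewrite mxE enum_rankK_in.
Qed.

(** Moving in direction [b], which leaves the integral coordinates of [a] alone,
    stop as soon as another coordinate becomes integral. Until then no coordinate
    crosses an integer, so integral bounds are preserved. *)
Lemma round_along (I : finType) (a b : I -> R) :
    (forall q, a q \is a Num.int -> b q = 0) -> (exists q, b q != 0) ->
  exists t, [/\ 0 < t,
    forall q (m : int), a q <= m%:~R -> a q + t * b q <= m%:~R,
    forall q (m : int), m%:~R <= a q -> m%:~R <= a q + t * b q &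
    exists q, a q \isn't a Num.int /\ a q + t * b q \is a Num.int].
Proof.
move=> b0 [q0 bq0].
pose r q := (if 0 < b q then Num.ceil (a q) else Num.floor (a q))%:~R : R.
(* [tau q] is the time at which coordinate [q] reaches the next integer. *)
pose tau q := (r q - a q) / b q.
have tau_gt0 q : b q != 0 -> 0 < tau q.
  move=> bq; have aq : a q \isn't a Num.int by apply: contraNN bq => /b0 ->.
  rewrite /tau /r; case: ifPn => [bp|]; last first.
    rewrite -leNgt le_eqVlt (negPf bq) /= => bn; rewrite nmulr_lgt0 ?invr_lt0 //.
    by rewrite subr_lt0 lt_neqAle floor_le_tmp andbT -intrEfloor.
  by rewrite divr_gt0 // subr_gt0 lt_neqAle ceil_ge andbT eq_sym -intrEceil.
have r_le q (m : int) : 0 < b q -> a q <= m%:~R -> r q <= m%:~R.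
  by rewrite /r => ->; rewrite ler_int ceil_le_int.
have r_ge q (m : int) : b q < 0 -> m%:~R <= a q -> m%:~R <= r q.
  by rewrite /r => bq; rewrite lt_gtF //= ler_int floor_ge_int.
case: (@arg_minP _ _ _ q0 (fun q => b q != 0) tau bq0) => q1 bq1 q1_min.
have t_gt0 := tau_gt0 _ bq1; exists (tau q1); split=> //.
- move=> q m am; have [bp|bn|->] := ltrgt0P (b q); last by rewrite mulr0 addr0.
    apply: le_trans (r_le q m bp am); rewrite -lerBrDl -ler_pdivlMr //.
    by apply: q1_min; rewrite gt_eqF.
  by apply: le_trans am; rewrite gerDl mulr_ge0_le0 ?ltW.
- move=> q m am; have [bp|bn|->] := ltrgt0P (b q); last by rewrite mulr0 addr0.
    by apply: le_trans am _; rewrite lerDl mulr_ge0 ?ltW.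
  apply: le_trans (r_ge q m bn am) _; rewrite -lerBlDl -ler_ndivlMr //.
  by apply: q1_min; rewrite lt_eqF.
- exists q1; split; first by apply: contraNN bq1 => /b0 ->.
  by rewrite /tau divfK // addrC subrK /r.
Qed.

Section Circulation.
Variables (V1 V2 E : finType) (sup : E -> V1) (mkt : E -> V2).

Definition incident (v : V1 + V2) (e : E) :=
  match v with inl i => sup e == i | inr j => mkt e == j end.

(** Each node of [C] meets at least two edges of [F] and each edge has two ends,
    so [#|C| <= #|F|], and conservation at the nodes of [C] leaves a nonzero
    solution if the inequality is strict. In case of equality all ends of edges
    of [F] are in [C]; then one equation is redundant, because the flow out of
    the suppliers is the flow into the markets. *)
Lemma circulation (F : {set E}) (C : {set V1 + V2}) :
    F != set0 ->
    (forall v, v \in C -> (1 < #|[set e in F | incident v e]|)%N) ->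
  exists h : E -> R, [/\ exists e, h e != 0, forall e, e \notin F -> h e = 0 &
    forall v, v \in C -> \sum_(e | incident v e) h e = 0].
Proof.
move=> /set0Pn[e0 e0F] deg2.
pose L (v : V1 + V2) e : R := (incident v e)%:R.
have sumL (h : E -> R) v : \sum_e h e * L v e = \sum_(e | incident v e) h e.
  rewrite [RHS]big_mkcond; apply: eq_bigr => e _; rewrite /L.
  by case: ifP; rewrite ?mulr1 ?mulr0.
have incE v e : (incident v e = (v == inl (sup e)) + (v == inr (mkt e)) :> nat)%N.
  by case: v => x; rewrite /= eq_sym [in RHS]/eq_op /= ?addn0.
have mem_sum (a : V1 + V2) : (\sum_(v in C) (v == a) = (a \in C))%N.
  have [aC|aC] := boolP (a \in C).
    by rewrite (bigD1 a) //= eqxx big1 // => v /andP[_ /negPf->].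
  by rewrite big1 // => v vC; apply/eqP; rewrite eqb0; apply: contraNneq aC => <-.
pose deg e := ((inl (sup e) \in C) + (inr (mkt e) \in C))%N.
have deg_le e : (deg e <= 2)%N by rewrite /deg; do 2!case: (_ \in C).
have sum_deg : (2 * #|C| <= \sum_(e in F) deg e)%N.
  apply: leq_trans (_ : \sum_(v in C) \sum_(e in F) incident v e <= _)%N.
    rewrite mulnC -sum_nat_const; apply: leq_sum => v /deg2/leq_trans; apply.
    by rewrite -sum1_card big_mkcond [leqRHS]big_mkcond leq_sum // => e _;
      rewrite inE; case: (e \in F); case: (incident v e).
  rewrite exchange_big leq_sum // => e _; rewrite /deg -!mem_sum -big_split /=.
  by rewrite leq_sum // => v _; rewrite incE.
have deg_sum : (\sum_(e in F) deg e <= 2 * #|F|)%N.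
  by rewrite mulnC -sum_nat_const leq_sum.
have [CF|FC] := ltnP #|C| #|F|.
  have [h [h0 hF hC]] := kernel_vector L CF.
  by exists h; split=> // v /hC; rewrite sumL.
have full e : e \in F -> (inl (sup e) \in C) && (inr (mkt e) \in C).
  move=> eF; suff : deg e = 2 by rewrite /deg; do 2!case: (_ \in C).
  apply/eqP; rewrite eqn_leq deg_le leqNgt /=; apply/negP => deg_lt.
  have : (\sum_(e in F) deg e < \sum_(e in F) 2)%N.
    rewrite (bigD1 e) //= [X in (_ < X)%N](bigD1 e) //= -addSn leq_add //.
    exact: leq_sum.
  by rewrite sum_nat_const; lia.
pose c0 : V1 + V2 := inr (mkt e0).
have c0C : c0 \in C by have /andP[] := full e0 e0F.
have CF : (#|C :\ c0| < #|F|)%N.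
  have : (#|C| <= #|F|)%N.
    by have := leq_trans sum_deg deg_sum; rewrite leq_pmul2l.
  by rewrite (cardsD1 c0 C) c0C.
have [h [h0 hF hC]] := kernel_vector L CF.
have zero v : v != c0 -> \sum_(e | incident v e) h e = 0.
  move=> vc; have [vC|vC] := boolP (v \in C).
    by rewrite -sumL hC // !inE vc.
  apply: big1 => e ve; apply: hF; apply: contra vC => /full.
  by case: v ve {vc} => x /= /eqP <- /andP[].
exists h; split=> // v _; have [->|/zero//] := eqVneq v c0.
have total0 : \sum_e h e = 0.
  rewrite (partition_big sup predT) //=; apply: big1 => i _.
  exact: (zero (inl i)).
move: total0; rewrite (partition_big mkt predT) //= (bigD1 (mkt e0)) //=.
rewrite [X in _ + X]big1 ?addr0 // => j j0; exact: (zero (inr j)).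
Qed.

(** The quantities to be made integral; the totals at the markets are not among
    them, being integral from the start. *)
Definition flow_value (x : E -> R) (q : E + V1) : R :=
  match q with inl e => x e | inr i => \sum_(e | sup e == i) x e end.

Definition fractionality (x : E -> R) :=
  #|[set q | flow_value x q \isn't a Num.int]|.

Definition rounds_to (x y : E -> R) :=
  [/\ (fractionality y < fractionality x)%N,
    forall q (m : int), flow_value x q <= m%:~R -> flow_value y q <= m%:~R,
    forall q (m : int), m%:~R <= flow_value x q -> m%:~R <= flow_value y q &
    forall j, \sum_(e | mkt e == j) y e = \sum_(e | mkt e == j) x e].

(** The edges to move are the fractional ones, and conservation is required at
    the nodes with an integral total. Such a node meets two fractional edges as
    soon as it meets one, which is what [circulation] needs. *)
Lemma integral_direction (x : E -> R) :
    (exists e, x e \isn't a Num.int) ->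
    (forall j, \sum_(e | mkt e == j) x e \is a Num.int) ->
  exists h : E -> R, [/\ exists e, h e != 0,
    forall q, flow_value x q \is a Num.int -> flow_value h q = 0 &
    forall j, \sum_(e | mkt e == j) h e = 0].
Proof.
move=> [e0 xe0] int_mkt.
pose F := [set e | x e \isn't a Num.int].
pose C := [set v | [exists e in F, incident v e] &&
                   (\sum_(e | incident v e) x e \is a Num.int)].
have F0 : F != set0 by apply/set0Pn; exists e0; rewrite inE.
have deg2 v : v \in C -> (1 < #|[set e in F | incident v e]|)%N.
  rewrite inE => /andP[/existsP[e /andP[eF ve]]]; rewrite (bigD1 e ve) /=.
  apply: contraTT; rewrite -leqNgt => card_le1.
  rewrite rpredDr; first by rewrite inE in eF.
  apply: rpred_sum => f /andP[vf fe]; apply: contraNT fe => xf.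
  rewrite inE in eF; apply/eqP; apply: (card_le1_eqP card_le1);
    by rewrite !inE ?vf ?ve ?xf ?eF.
have [h [h0 hF hC]] := circulation F0 deg2.
have h_sum v : \sum_(e | incident v e) x e \is a Num.int ->
    \sum_(e | incident v e) h e = 0.
  move=> xv; have [vF|/existsPn vF] := boolP [exists e in F, incident v e].
    by apply: hC; rewrite inE vF.
  apply: big1 => e ve; apply: hF; have := vF e.
  by rewrite ve andbT.
exists h; split=> // [[e|i]|j].
- by move=> /= xe; apply: hF; rewrite inE xe.
- exact: (h_sum (inl i)).
- exact: (h_sum (inr j) (int_mkt j)).
Qed.

(** Rounding along a direction and its opposite gives two points with [x] on the
    segment between them. *)
Lemma rounding_step (x : E -> R) :
    (exists e, x e \isn't a Num.int) ->
    (forall j, \sum_(e | mkt e == j) x e \is a Num.int) ->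
  exists y1 y2 t, [/\ rounds_to x y1, rounds_to x y2, 0 <= t <= 1 &
    forall e, x e = t * y1 e + (1 - t) * y2 e].
Proof.
move=> frac_x int_mkt.
have [h [h0 hx hmkt]] := integral_direction frac_x int_mkt.
have along (g : E -> R) : (exists e, g e != 0) ->
    (forall q, flow_value x q \is a Num.int -> flow_value g q = 0) ->
    (forall j, \sum_(e | mkt e == j) g e = 0) ->
    exists2 t, 0 < t & rounds_to x (fun e => x e + t * g e).
  move=> [e ge] gx gmkt.
  have valE t q : flow_value (fun e => x e + t * g e) q =
      flow_value x q + t * flow_value g q.
    by case: q => //= i; rewrite big_split mulr_sumr.
  have [|t [t0 up lo [q [xq yq]]]] := round_along gx; first by exists (inl e).
  exists t => //; split=> [|p m|p m|j].
  - apply/proper_card/properP; split; last by exists q; rewrite !inE ?valE ?yq.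
    apply/subsetP => p; rewrite !inE valE; apply: contraNN => xp.
    by rewrite gx // mulr0 addr0.
  - by rewrite valE; apply: up.
  - by rewrite valE; apply: lo.
  - by rewrite big_split /= -mulr_sumr gmkt mulr0 addr0.
have [t1 t1_gt0 xy1] := along h h0 hx hmkt.
have [|||t2 t2_gt0 xy2] := along (fun e => - h e).
- by have [e he] := h0; exists e; rewrite oppr_eq0.
- by case=> [e|i] /hx /= hq; rewrite ?sumrN hq oppr0.
- by move=> j; rewrite sumrN hmkt oppr0.
exists (fun e => x e + t1 * h e), (fun e => x e + t2 * - h e), (t2 / (t1 + t2)).
have t12 : t1 + t2 != 0 by rewrite gt_eqF ?addr_gt0.
split=> //; last by move=> e; field.
have t12_gt0 : 0 < t1 + t2 by rewrite addr_gt0.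
by rewrite ler_pdivrMr // mul1r lerDr (ltW t1_gt0) divr_ge0 // ltW.
Qed.

End Circulation.
End Rounding.

From mathcomp Require Import interval_inference boolp classical_sets reals convex.
Local Open Scope classical_set_scope.

(** * Convex hulls of layers *)

Section Hull.
Set Implicit Arguments.
Unset Strict Implicit.
Variables (R : realType) (M : lmodType R).
Implicit Types (A B : set M) (u v : M) (t : R).

(** [convex_set] with the interval-typed coefficient spelled out. *)
Definition mix_closed B :=
  forall u v t, B u -> B v -> 0 <= t -> t <= 1 -> B (t *: u + (1 - t) *: v).

Lemma mix_closedP B : mix_closed B <-> @convex_set R M B.
Proof.
split=> [cB u v t|cB u v t Bu Bv t0 t1].
  by rewrite !inE => Bu Bv; apply: cB.
by have := cB u v (Itv01 t0 t1); rewrite !inE => /(_ Bu Bv).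
Qed.

Lemma hull_mix A : mix_closed (convex_hull A).
Proof.
move=> u v t Au Av t0 t1 B [cB AB].
by move/mix_closedP: (cB); apply=> //; [apply: Au | apply: Av].
Qed.

Lemma sub_hull A : A `<=` convex_hull A.
Proof. exact: sub_gen_smallest. Qed.

Lemma hull_min A B : mix_closed B -> A `<=` B -> convex_hull A `<=` B.
Proof. by move=> /mix_closedP; apply: smallest_sub. Qed.

Lemma hullS A B : A `<=` B -> convex_hull A `<=` convex_hull B.
Proof.
by move=> AB; apply: hull_min; [apply: hull_mix | move=> u /AB/sub_hull].
Qed.

Definition exchangeable A B A' B' := forall u v,
  convex_hull A u -> convex_hull B v ->
  exists u' v', [/\ convex_hull A' u', convex_hull B' v' & u + v = u' + v'].

(** The sum of the hulls of [A] and [B] is the hull of the sum of [A] and [B], so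
    it is enough to exchange generating points. *)
Lemma hull_exchange A B A' B' :
    (forall u v, A u -> B v ->
      exists u' v', [/\ A' u', B' v' & u + v = u' + v']) ->
  exchangeable A B A' B'.
Proof.
move=> exch.
pose D := [set w | exists u' v',
  [/\ convex_hull A' u', convex_hull B' v' & w = u' + v']].
have mixD : mix_closed D.
  move=> _ _ t [u1 [v1 [Au1 Bv1 ->]]] [u2 [v2 [Au2 Bv2 ->]]] t0 t1.
  exists (t *: u1 + (1 - t) *: u2), (t *: v1 + (1 - t) *: v2).
  by split; [exact: hull_mix | exact: hull_mix | rewrite !scalerDr addrACA].
have mixE t w w' v :
    t *: w + (1 - t) *: w' + v = t *: (w + v) + (1 - t) *: (w' + v).
  by rewrite !scalerDr addrACA -scalerDl [t + _]addrC subrK scale1r.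
move=> u v Au Bv; suff : D (u + v) by [].
have {}Au v' : B v' -> D (u + v').
  move=> Bv'; apply: (@hull_min A [set u | D (u + v')]) Au => [x y t /=|x Ax].
    by move=> Dx Dy t0 t1; rewrite mixE; apply: mixD.
  have [u1 [v1 [Au1 Bv1 e]]] := exch x v' Ax Bv'.
  by exists u1, v1; split=> //; apply: sub_hull.
apply: (@hull_min B [set v | D (u + v)]) Bv => [x y t /=|//].
by move=> Dx Dy t0 t1; rewrite addrC mixE ![_ + u]addrC; apply: mixD.
Qed.

(** The cone over the hull of [A] placed at height 1; the second component is the
    weight that a point of the hull has in a mixture. Working with cones turns
    mixtures into plain sums and allows weight 0 on an empty layer. *)
Definition hull_cone A : set (M * R^o) :=
  [set q | q = 0 \/
    exists c, [/\ 0 < q.2, convex_hull A c & q.1 = (q.2 : R) *: c]].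

Lemma hull_cone0 A : hull_cone A 0.
Proof. by left. Qed.

Lemma hull_coneD A q r : hull_cone A q -> hull_cone A r -> hull_cone A (q + r).
Proof.
move=> [->|[c [q0 Ac qc]]]; first by rewrite add0r.
move=> [->|[c' [r0 Ac' rc']]]; first by rewrite addr0; right; exists c.
right; have qr0 : 0 < (q.2 + r.2 : R) by rewrite addr_gt0.
exists ((q.2 / (q.2 + r.2) : R) *: c + (1 - q.2 / (q.2 + r.2) : R) *: c').
split=> //; first apply: hull_mix => //.
- by rewrite divr_ge0 // ltW.
- by rewrite ler_pdivrMr // mul1r lerDl ltW.
have qr_neq0 : (q.2 + r.2 : R) != 0 by rewrite gt_eqF.
rewrite /= qc rc' scalerDr !scalerA; congr (_ *: _ + _ *: _); by field.
Qed.

Lemma hull_coneZ A t q : 0 <= t -> hull_cone A q -> hull_cone A (t *: q).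
Proof.
rewrite le_eqVlt => /orP[/eqP <-|t0]; first by rewrite scale0r; left.
case=> [->|[c [q0 Ac qc]]]; first by rewrite scaler0; left.
by right; exists c; split=> //=; [apply: mulr_gt0 | rewrite qc scalerA].
Qed.

(** Weights need not agree: the smaller weight is exchanged completely, and the
    excess [o] of the larger one stays where it is. *)
Lemma hull_cone_exchange A B A' B' : exchangeable A B A' B' ->
  forall q r, hull_cone A q -> hull_cone B r -> exists q' r' o,
    [/\ hull_cone A' q', hull_cone B' r', hull_cone A o \/ hull_cone B o &
        q + r = q' + r' + o].
Proof.
move=> exch q r Aq Br.
wlog qr : A B A' B' q r exch Aq Br / (q.2 : R) <= r.2.
  move=> wl; have [qr|rq] := lerP (q.2 : R) r.2; first exact: wl exch Aq Br qr.
  have [v u Bv Au|r' [q' [o [Br' Aq' oAB e]]]] := wl B A B' A' r q _ Br Aq (ltW rq).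
    have [u' [v' [? ? uv]]] := exch u v Au Bv.
    by exists v', u'; rewrite addrC uv addrC.
  exists q', r', o; split=> //; first by case: oAB; [right|left].
  by rewrite addrC e [r' + q']addrC.
case: (Aq) => [->|[c [q0 Ac qc]]].
  by exists 0, 0, r; split; [left|left|right|rewrite addr0].
case: (Br) => [->|[c' [r0 Bc' rc']]].
  by exists 0, 0, q; split; [left|left|left|rewrite !addr0 add0r].
have [u' [v' [Au' Bv' uv']]] := exch c c' Ac Bc'.
have cone_pt D x w : 0 < w -> convex_hull D x -> hull_cone D (w *: x, w).
  by move=> w0 Dx; right; exists x.
exists ((q.2 : R) *: u', q.2), ((q.2 : R) *: v', q.2),
  ((r.2 - q.2 : R) *: c', r.2 - q.2).
split; [exact: cone_pt | exact: cone_pt | right |].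
  move: qr; rewrite le_eqVlt => /orP[/eqP <-|qr].
    by rewrite subrr scale0r; left.
  by apply: cone_pt; rewrite // subr_gt0.
have pairE (x y : M * R^o) : x.1 = y.1 -> x.2 = y.2 -> x = y.
  by case: x y => [? ?] [? ?] /= -> ->.
apply: pairE => /=; last by rewrite -addrA [q.2 + (_ - _)]addrC subrK.
rewrite qc rc' -scalerDr -uv' scalerDr scalerBl.
by rewrite -addrA [_ *: c' + _]addrC subrK.
Qed.

Variables (L : nat -> set M).
Hypothesis L_exch : forall a b, (a.+2 <= b)%N ->
  exchangeable (L a) (L b) (L a.+1) (L b.-1).

(** Exchanging between the two extreme layers [a] and [b] of the window leaves
    weight on only one of them, so the window gets shorter. The sums run over one
    range below [N] for all windows. *)
Lemma concentrate (N k a : nat) (q : nat -> M * R^o) : (a + k.+1 < N)%N ->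
    (forall m, hull_cone (L m) (q m)) ->
    (forall m, (m < a)%N || (a + k.+1 < m)%N -> q m = 0) ->
  exists c x y, [/\ hull_cone (L c) x, hull_cone (L c.+1) y &
    \sum_(0 <= m < N) q m = x + y].
Proof.
have at1 a' (x : M * R^o) : (a' < N)%N ->
    \sum_(0 <= m < N) (if m == a' then x else 0) = x.
  by move=> aN; rewrite -big_mkcond big_nat1_eq aN.
have erase (q' : nat -> M * R^o) a' : (a' < N)%N ->
    \sum_(0 <= m < N) q' m =
    q' a' + \sum_(0 <= m < N) (if m == a' then 0 else q' m).
  move=> aN; rewrite -{1}(at1 a' (q' a') aN) -big_split /=.
  by apply: eq_bigr => m _; case: eqP => [->|]; rewrite ?addr0 ?add0r.
elim: k a q => [|k IHk] a q aN Lq q_supp.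
  have [aN' aN''] : (a < N)%N /\ (a.+1 < N)%N by lia.
  exists a, (q a), (q a.+1); split=> //.
  rewrite (erase q a) // (erase _ a.+1) // big1 ?addr0 ?(gtn_eqF (ltnSn a)) //.
  move=> m _; case: eqP => // ma1; case: eqP => // ma; apply: q_supp; lia.
pose b := (a + k.+2)%N.
have [aN1 a1N bN b1N] : [/\ a < N, a.+1 < N, b < N & b.-1 < N]%N.
  by rewrite /b; split; lia.
have ab : (a.+2 <= b)%N by rewrite /b; lia.
have [x [y [o [Lx Ly Lo e]]]] :=
  hull_cone_exchange (@L_exch _ _ ab) (Lq a) (Lq b).
pose inner m := if m == b then 0 else if m == a then 0 else q m.
have sum_q (c : nat) : (c < N)%N -> \sum_(0 <= m < N) q m = \sum_(0 <= m < N)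
    (inner m + (if m == a.+1 then x else 0) + (if m == b.-1 then y else 0)
             + (if m == c then o else 0)).
  move=> cN; rewrite !big_split /= !at1 // (erase q a) // (erase _ b) // addrA.
  rewrite gtn_eqF ?e; last by rewrite /b; lia.
  by rewrite [LHS]addrC !addrA.
(* With [inner] the part of [q] strictly between [a] and [b], the new family is
   supported on a shorter window wherever the excess [o] remains. *)
have step c a' : (c < N)%N -> hull_cone (L c) o -> (a' + k.+1 < N)%N ->
    (forall m, (m < a')%N || (a' + k.+1 < m)%N ->
      [/\ m != a.+1, m != b.-1, m != c & inner m = 0]) ->
  exists c x y, [/\ hull_cone (L c) x, hull_cone (L c.+1) y &
    \sum_(0 <= m < N) q m = x + y].
  move=> cN Lco a'N supp; rewrite (sum_q c cN); apply: (IHk a') => // m.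
    have cone_if i (z : M * R^o) : hull_cone (L i) z ->
        hull_cone (L m) (if m == i then z else 0).
      by move=> Lz; case: eqP => [->//|_]; exact: hull_cone0.
    do !apply: hull_coneD; try exact: cone_if.
    by rewrite /inner; do !case: ifP => _ //; exact: hull_cone0.
  by case/supp => /negPf-> /negPf-> /negPf-> ->; rewrite !addr0.
case: Lo => Lo; [apply: (step a a) | apply: (step b a.+1)] => //; rewrite /b; try lia.
  move=> m m_out; split; [lia|lia|lia|].
  by rewrite /inner; case: eqP => // mb; case: eqP => // ma; apply: q_supp; lia.
move=> m m_out; split; [lia|lia|lia|].
by rewrite /inner; case: eqP => // mb; case: eqP => // ma; apply: q_supp; lia.
Qed.

(** The sums of one cone element per layer, of total weight 1, form a convex set
    containing [X]; [concentrate] reduces such a sum to two terms. *)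
Lemma hull_consecutive (X : set M) (n : nat) p :
    (forall x, X x -> exists2 m, (m <= n)%N & convex_hull (L m) x) ->
    convex_hull X p ->
  exists c x y, [/\ hull_cone (L c) x, hull_cone (L c.+1) y & (p, 1) = x + y].
Proof.
move=> XL.
pose D := [set p | exists q : nat -> M * R^o, [/\ forall m, hull_cone (L m) (q m),
  forall m, (n < m)%N -> q m = 0 & \sum_(0 <= m < n.+2) q m = (p, 1)]].
have mixD : mix_closed D.
  move=> u v t [q [Lq q0 qE]] [r [Lr r0 rE]] t0 t1.
  exists (fun m => t *: q m + (1 - t) *: r m); split=> [m|m nm|].
  - by apply: hull_coneD; apply: hull_coneZ; rewrite ?subr_ge0.
  - by rewrite q0 // r0 // !scaler0 addr0.
  - rewrite big_split /= -!scaler_sumr qE rE; congr (_, _).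
    by rewrite /= /GRing.scale /= !mulr1 addrC subrK.
have XD : X `<=` D.
  move=> x /XL[m mn Lx]; exists (fun i => if i == m then (x, 1) else 0); split.
  - move=> i; case: eqP => [->|_]; last exact: hull_cone0.
    by right; exists x; rewrite /= scale1r.
  - by move=> i ni; case: eqP => // im; move: ni; rewrite im ltnNge mn.
  - by rewrite -big_mkcond big_nat1_eq ltnS (leqW mn).
move/(hull_min mixD XD) => [q [Lq q0 <-]].
apply: (@concentrate _ n 0) => // m; rewrite ltn0 add0n /= => nm.
by apply: q0; apply: ltnW.
Qed.

End Hull.

(** * The transportation problem with market choice *)

Section Layers.
Set Implicit Arguments.
Unset Strict Implicit.
Variables (R : realType) (V1 V2 : finType) (E : {set V1 * V2}).
Variables (s : V1 -> nat) (d : V2 -> nat).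
Local Notation space := ({ffun edge E -> R^o} * {ffun V2 -> R^o})%type.
Local Notation sup := (fun e : edge E => (val e).1).
Local Notation mkt := (fun e : edge E => (val e).2).
Local Notation X := (tpmc_feasible R E s d).

Definition flow_point (n : edge E -> nat) (z : V2 -> bool) : space :=
  ([ffun e => (n e)%:R], [ffun j => (z j)%:R]).

Definition layer (m : nat) : set space :=
  [set p | exists n z, [/\ flow_feasible sup mkt s d n z, (\sum_j z j)%N = m &
                           p = flow_point n z]].

Lemma layer_exchange : (forall j, (0 < d j <= 2)%N) ->
  forall a b, (a.+2 <= b)%N ->
  exchangeable (layer a) (layer b) (layer a.+1) (layer b.-1).
Proof.
move=> d12 a b ab; apply: hull_exchange.
move=> _ _ [n1 [z1 [feas1 z1a ->]]] [n2 [z2 [feas2 z2b ->]]].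
have [||n' [z' [feas' nE zE count]]] := @flow_exchange V1 V2 (edge E) sup mkt s d
  (fun c => if c then n1 else n2) (fun c => if c then z1 else z2) d12.
- by case.
- by rewrite z1a z2b.
have z'b : (\sum_j z' false j)%N = b.-1.
  have : (\sum_j z' true j + \sum_j z' false j = \sum_j z1 j + \sum_j z2 j)%N.
    by rewrite -!big_split /=; apply: eq_bigr => j _; apply: zE.
  by rewrite count z1a z2b; lia.
exists (flow_point (n' true) (z' true)), (flow_point (n' false) (z' false)).
split.
- by exists (n' true), (z' true); rewrite count z1a.
- by exists (n' false), (z' false).
- by congr (_, _); apply/ffunP => i; rewrite !ffunE -!natrD ?nE ?zE.
Qed.

Lemma layer_feasible m p : layer m p ->
  X p /\ \sum_j reject p j = m%:R.
Proof.
move=> [n [z [[dem cap] zm ->]]]; rewrite /reject /ship /=.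
split; last by rewrite -zm natr_sum; apply: eq_bigr => j _; rewrite ffunE.
split; split.
- by move=> e; rewrite /ship ffunE ler0n.
- by move=> j; rewrite /reject ffunE; case: (z j); [right|left].
- move=> j; rewrite /ship /reject ffunE; under eq_bigr do rewrite ffunE.
  by rewrite -natr_sum dem natrM; case: (z j); rewrite ?subrr ?subr0.
- move=> i; rewrite /ship; under eq_bigr do rewrite ffunE.
  by rewrite -natr_sum ler_nat cap.
Qed.

(** The number of rejections is affine, so it stays constant on the hull. *)
Lemma hull_layer_level m p : convex_hull (layer m) p -> \sum_j reject p j = m%:R.
Proof.
apply: (@hull_min _ _ _ [set p | \sum_j reject p j = m%:R])
  => [u v t /=|q /layer_feasible[]//].
move=> um vm _ _; transitivity (t * m%:R + (1 - t) * m%:R : R); last by ring.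
rewrite -{1}um -vm !mulr_sumr -big_split /=; apply: eq_bigr => j _.
by rewrite /reject !ffunE.
Qed.

(** Rounding the shipments at fixed rejections, by induction on the number of
    fractional quantities. *)
Lemma feasible_layer p :
  X p -> exists2 m, (m <= #|V2|)%N & convex_hull (layer m) p.
Proof.
case: p => x z [[x_ge0 z01] [dem cap]].
pose zb j := z j == 1.
have zE j : z j = (zb j)%:R.
  have := z01 j; rewrite /reject /zb /= => -[->|->]; rewrite ?eqxx //.
  by rewrite eq_sym oner_eq0.
exists (\sum_j zb j)%N.
  by rewrite -sum1_card leq_sum // => j _; case: (zb j).
move: x_ge0 dem cap; clear z01; have [N] := ubnP (fractionality sup x).
elim: N x => // N IHN x xN x_ge0 dem cap.
have int_dem j : \sum_(e | mkt e == j) x e \is a Num.int.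
  by rewrite dem /reject /= zE rpredM ?rpredB ?rpred1 ?rpred_nat.
have [/existsP frac_x|/existsPn int_x] := boolP [exists e, x e \isn't a Num.int].
  pose pt (y : edge E -> R) : space := ([ffun e => y e], z).
  have [y1 [y2 [t [xy1 xy2 /andP[t0 t1] xE]]]] :=
    rounding_step sup frac_x int_dem.
  have hull_y y : rounds_to sup mkt x y -> convex_hull (layer (\sum_j zb j)) (pt y).
    move=> [y_frac up lo y_dem]; pose yf := [ffun e => y e] : {ffun edge E -> R^o}.
    have yfE : yf =1 y by move=> e; rewrite ffunE.
    apply: IHN.
    - have -> : (yf : edge E -> R) = y by apply/funext.
      exact: leq_trans y_frac _.
    - by move=> e; rewrite /ship /= yfE (lo (inl e) 0) //; apply: x_ge0.
    - by move=> j; rewrite -dem /ship /= -y_dem; apply: eq_bigr => e _; apply: yfE.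
    - move=> i; rewrite /ship /= (eq_bigr y) => [|e _]; last exact: yfE.
      by apply: (up (inr i) (s i)); apply: cap.
  have -> : (x, z) = t *: pt y1 + (1 - t) *: pt y2.
    congr (_, _); apply/ffunP => i; rewrite !ffunE; first exact: xE.
    by rewrite -scalerDl addrC subrK scale1r.
  by apply: hull_mix => //; apply: hull_y.
have xE e : x e = (Num.truncn (x e))%:R.
  apply/esym/truncnK; rewrite natrEint x_ge0 andbT; have := int_x e.
  by rewrite negbK.
apply: sub_hull; exists (fun e => Num.truncn (x e)), zb; split=> //; last first.
  by congr (_, _); apply/ffunP => i; rewrite ffunE.
split=> [j|i].
  apply/eqP; rewrite -(eqr_nat R) natr_sum natrM.
  rewrite (eq_bigr x) => [|e _]; last exact/esym/xE.
  by rewrite dem /reject /= zE; case: (zb j); rewrite ?subrr ?subr0.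
rewrite -(ler_nat R) natr_sum (eq_bigr x) => [|e _]; last exact/esym/xE.
exact: cap.
Qed.

End Layers.

Theorem theorem1 (R : realType) (V1 V2 : finType) (E : {set V1 * V2})
    (s : V1 -> nat) (d : V2 -> nat) (k : nat)
    (s_gt0 : forall i, (0 < s i)%N) (d_gt0 : forall j, (0 < d j)%N)
    (k_le : (k <= #|V2|)%N) (d_le2 : forall j, (d j <= 2)%N) :
  convex_hull (tpmc_feasible R E s d `&`
               (nonneg_binary `&` at_most_rejected k))
  = convex_hull (tpmc_feasible R E s d) `&`
    (nonneg_unit `&` at_most_rejected k).
Proof.
apply/seteqP; split=> p.
  move=> Xk; split; first by apply: hullS Xk => q [].
  apply: hull_min Xk => [u v t|q [_ [[q_ge0 q01] qk]]]; last first.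
    by split=> //; split=> // j; case: (q01 j) => ->; rewrite ?lexx ler01.
  move=> [[u_ge0 u01] uk] [[v_ge0 v01] vk] t0 t1.
  have t1' : 0 <= 1 - t by rewrite subr_ge0.
  split; first split.
  - by move=> e; rewrite /ship !ffunE addr_ge0 ?mulr_ge0 ?u_ge0 ?v_ge0.
  - move=> j; have /andP[uj0 uj1] := u01 j; have /andP[vj0 vj1] := v01 j.
    rewrite /reject !ffunE addr_ge0 ?mulr_ge0 //=.
    by rewrite -[leRHS](subrK t) [leRHS]addrC lerD // ler_piMr.
  - rewrite /at_most_rejected /=.
    have -> : \sum_j reject (t *: u + (1 - t) *: v) j =
        t * \sum_j reject u j + (1 - t) * \sum_j reject v j.
      by rewrite !mulr_sumr -big_split; apply: eq_bigr => j _; rewrite /reject !ffunE.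
    apply: (@le_trans _ _ (t * k%:R + (1 - t) * k%:R)).
      by rewrite lerD // ler_wpM2l.
    by rewrite -mulrDl addrC subrK mul1r.
move=> [Xp [_ pk]].
have d12 j : (0 < d j <= 2)%N by rewrite d_gt0 d_le2.
have [c [x [y [Lx Ly pxy]]]] := hull_consecutive (@layer_exchange R V1 V2 E s d d12)
  (@feasible_layer R V1 V2 E s d) Xp.
have low m q : (m <= k)%N -> convex_hull (@layer R V1 V2 E s d m) q ->
    convex_hull (tpmc_feasible R E s d `&` (nonneg_binary `&` at_most_rejected k)) q.
  move=> mk; apply: hullS => r /layer_feasible[Xr rm]; split=> //.
  by split; [case: Xr | rewrite /at_most_rejected /= rm ler_nat].
have p1 : p = x.1 + y.1 by have := congr1 fst pxy.
have w1 : 1 = x.2 + y.2 :> R by have := congr1 snd pxy.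
case: Lx p1 w1 => [->|[cx [x_gt0 Lcx ->]]].
  case: Ly => [->|[cy [_ Lcy ->]]]; rewrite !add0r => pE wE.
    by move/eqP: wE; rewrite oner_eq0.
  move: pE; rewrite -wE scale1r => pE; rewrite pE; apply: low (Lcy).
  by rewrite -(ler_nat R) -(hull_layer_level Lcy) -pE.
case: Ly => [->|[cy [y_gt0 Lcy ->]]]; rewrite ?addr0 => pE wE.
  move: pE; rewrite -wE scale1r => pE; rewrite pE; apply: low (Lcx).
  by rewrite -(ler_nat R) -(hull_layer_level Lcx) -pE.
(* The number of rejections at [p] is [c + y.2] with [y.2 > 0]. *)
have ck : (c < k)%N.
  rewrite -(ltr_nat R); apply: lt_le_trans pk.
  have -> : \sum_j reject p j =
      x.2 * \sum_j reject cx j + y.2 * \sum_j reject cy j.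
    rewrite !mulr_sumr -big_split; apply: eq_bigr => j _.
    by rewrite pE /reject !ffunE.
  rewrite (hull_layer_level Lcx) (hull_layer_level Lcy) mulrSr mulrDr mulr1 addrA.
  by rewrite -mulrDl -wE mul1r ltrDl.
have yE : y.2 = 1 - x.2 :> R by rewrite wE addrC addKr.
rewrite pE yE; apply: hull_mix;
  [exact: low (ltnW ck) Lcx | exact: low ck Lcy | exact: ltW |].
by rewrite wE lerDl ltW.
Qed.
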